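(* For every positive integer $n \le 20$, $R(B_{n-1},B_n) = 4n-1$. Moreover, for every positive integer $n$ such that $2n-1$ is a prime power congruent to $1$ modulo $4$, $R(B_{n-1},B_n) = 4n-1$.
   Context: All graphs are finite, simple and undirected. The book graph $B_n = K_2 + \overline{K_n}$ (where $+$ denotes the graph join) consists of $n$ triangles sharing a common edge; it has $n+2$ vertices, and in the degenerate case $B_0 = K_2$. For graphs $G,H$, the Ramsey number $R(G,H)$ is the smallest positive integer $N$ such that for every graph $X$ on $N$ vertices, either $X$ contains a copy of $G$ as a (not necessarily induced) subgraph, or the complement of $X$ contains a copy of $H$ as a (not necessarily induced) subgraph. *)

(* Defs.v *)
From mathcomp Require Import all_boot.

Set Implicit Arguments.
Unset Strict Implicit.
Unset Printing Implicit Defensive.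

Record sgraph := SGraph {
  vertex :> finType;
  adj : rel vertex;
  adj_sym : symmetric adj;
  adj_irr : irreflexive adj
}.

Section Complement.
Variable G : sgraph.

Definition compl_rel : rel G := fun x y => (x != y) && ~~ adj x y.

Lemma compl_sym : symmetric compl_rel.
Proof. by move=> x y; rewrite /compl_rel eq_sym adj_sym. Qed.

Lemma compl_irr : irreflexive compl_rel.
Proof. by move=> x; rewrite /compl_rel eqxx. Qed.

Definition compl : sgraph := SGraph compl_sym compl_irr.
End Complement.

Section Join.
Variables G H : sgraph.

Definition join_rel : rel (G + H)%type := fun u v =>
  match u, v with
  | inl x, inl y => adj x y
  | inr x, inr y => adj x y
  | _, _ => true
  end.

Lemma join_sym : symmetric join_rel.
Proof. by move=> [x|x] [y|y] //=; rewrite adj_sym. Qed.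

Lemma join_irr : irreflexive join_rel.
Proof. by move=> [x|x] /=; rewrite adj_irr. Qed.

Definition join : sgraph := SGraph join_sym join_irr.
End Join.

Section Complete.
Variable n : nat.

Definition complete_rel : rel 'I_n := fun x y => x != y.

Lemma complete_sym : symmetric complete_rel.
Proof. by move=> x y; rewrite /complete_rel eq_sym. Qed.

Lemma complete_irr : irreflexive complete_rel.
Proof. by move=> x; rewrite /complete_rel eqxx. Qed.

Definition complete : sgraph := SGraph complete_sym complete_irr.
End Complete.

Definition book (n : nat) : sgraph := join (complete 2) (compl (complete n)).

(* Not necessarily induced: non-adjacent pairs are unconstrained. *)
Definition contains (X G : sgraph) : Prop :=
  exists f : G -> X,
    injective f /\ (forall x y : G, adj x y -> adj (f x) (f y)).

Definition arrows (N : nat) (G H : sgraph) : Prop :=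
  forall X : sgraph, #|X| = N -> contains X G \/ contains (compl X) H.

(* R(G, H) = N, as a relation: it includes the existence of the minimum. *)
Definition is_ramsey_number (G H : sgraph) (N : nat) : Prop :=
  [/\ 0 < N, arrows N G H
    & forall M : nat, 0 < M -> arrows M G H -> N <= M].

Definition prime_power (q : nat) : Prop :=
  exists p k : nat, [/\ prime p, 0 < k & q = p ^ k].

(* Main.v *)
Require Import Defs.
From mathcomp Require Import all_boot all_algebra finfield.
From mathcomp Require Import zify.

(** A copy of the book with k pages in G is the same thing as an edge of G
whose ends have at least k common neighbours ([contains_book],
[book_freeP]).  So a graph on N vertices witnesses R(B_(n-1), B_n) > N exactly
when adjacent vertices have at most n - 2 common neighbours, and distinct
nonadjacent vertices have at most n - 1 common non-neighbours.

Upper bound ([no_book_ramsey_graph]).  At a vertex x of degree d and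
co-degree d', the d * d' pairs (neighbour, non-neighbour) split into adjacent
and nonadjacent ones.  Adjacent ones are counted by degrees minus codegrees of
the edges at x, and the others in the same way in the complement.  Summing over
x and inserting the codegree bounds gives, with t = d - (2n - 1),
  sum over x of (3 t^2 + t) <= 0   on 4n - 1 vertices.
Since 3 t^2 + t > 0 for every nonzero integer t, the graph is regular of odd
degree 2n - 1 on an odd number of vertices, against the handshake lemma.

Lower bound ([bicayley_ramsey]).  Take two copies of an abelian group V of
order 2n - 1.  Put the Cayley graph of a symmetric set S on the first copy, the
complementary Cayley graph on the second, and join x to y across when y - x
lies in a fixed set T with n - 1 elements.  Because the two Cayley graphs are
complementary, the codegree of a crossing pair is |T| or |T| - 1 whatever S and T
are, and the complement of the graph is of the same form.  Only a bound on the
number of representations of each group element as a difference in S, in its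
complement, and in T remains.  When 2n - 1 = 1 mod 4 is a prime power, taking
for S and T the nonzero squares of the field with 2n - 1 elements meets this
bound, by the classical values of the cyclotomic numbers of order 2
([paley_ramsey]).  For the other n <= 20 except 2 and 4, suitable sets S and T in
the cyclic group of order 2n - 1 are listed and verified by evaluation, and for
n = 2 and n = 4 a graph is listed explicitly. *)

Set Implicit Arguments.
Unset Strict Implicit.
Unset Printing Implicit Defensive.

Import GRing.Theory.

(** * Books as edges of large codegree *)

Definition codeg (G : sgraph) (x y : G) : nat :=
  #|[set z | adj x z && adj y z]|.

Definition book_free (k : nat) (G : sgraph) : Prop :=
  forall x y : G, adj x y -> codeg x y < k.

Lemma contains_book (G : sgraph) (k : nat) (x y : G) :
  adj x y -> k <= codeg x y -> contains G (book k).
Proof.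
move=> xy; rewrite /codeg; set A := [set z | _] => kA.
have inA i : (enum_val (widen_ord kA i) : G) \in A by apply: enum_valP.
exists (fun u : book k => match u with
  | inl i => if i == ord0 then x else y
  | inr i => enum_val (widen_ord kA i) end); split.
- have xA : x \notin A by rewrite inE adj_irr.
  have yA : y \notin A by rewrite inE adj_irr andbF.
  have nxy : x != y by apply: contraTneq xy => ->; rewrite adj_irr.
  have base (i : 'I_2) : (if i == ord0 then x else y) \notin A by case: ifP.
  move=> [i|i] [j|j] /=.
  + have i2 (a b : 'I_2) : (a == ord0) = (b == ord0) -> a = b.
      by case: a b => [[|[|a]] a2] [[|[|b]] b2] //= _; apply: val_inj.
    move=> eqf; congr inl; apply: i2; move: eqf nxy.
    by case: (i == ord0) (j == ord0) => [] [] // ->; rewrite eqxx.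
  + by move=> eqf; have := inA j; rewrite -eqf (negPf (base i)).
  + by move=> eqf; have := inA i; rewrite eqf (negPf (base j)).
  + by move=> /enum_val_inj/(congr1 val) /= eqij; congr inr; apply: val_inj.
- move=> [i|i] [j|j] //=.
  + rewrite /complete_rel; case: i j => [[|[|i]] i2] [[|[|j]] j2] //= _.
    by rewrite adj_sym.
  + by move=> _; have := inA j; rewrite inE => /andP[]; case: ifP.
  + move=> _; have := inA i.
    by rewrite inE adj_sym [adj y _]adj_sym => /andP[]; case: ifP.
  + by rewrite /compl_rel /= /complete_rel andbN.
Qed.

Lemma book_freeP (G : sgraph) (k : nat) :
  book_free k G <-> ~ contains G (book k).
Proof.
split=> [freeG [f [f_inj f_adj]]|nG x y xy]; last first.
  by rewrite ltnNge; apply/negP => /(contains_book xy).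
pose x := f (inl ord0); pose y := f (inl ord_max).
have xy : adj x y by apply: f_adj.
have := freeG _ _ xy; rewrite ltnNge => /negP; apply.
rewrite -[k in k <= _]card_ord -(card_imset _ (inj_comp f_inj (@inr_inj 'I_2 'I_k))).
apply: subset_leq_card; apply/subsetP=> _ /imsetP[i _ ->].
by rewrite inE /= !f_adj.
Qed.

Lemma codeg_embed (G H : sgraph) (f : G -> H) (x y : G) :
  injective f -> (forall u v, adj u v -> adj (f u) (f v)) ->
  codeg x y <= codeg (f x) (f y).
Proof.
move=> f_inj f_adj; rewrite /codeg -(card_imset _ f_inj).
apply: subset_leq_card; apply/subsetP=> _ /imsetP[z + ->].
by rewrite !inE => /andP[/f_adj-> /f_adj->].
Qed.

Lemma book_free_embed (G H : sgraph) (f : G -> H) k :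
  injective f -> (forall u v, adj u v -> adj (f u) (f v)) ->
  book_free k H -> book_free k G.
Proof.
move=> f_inj f_adj freeH x y /f_adj/freeH; apply: leq_ltn_trans.
exact: codeg_embed.
Qed.

Section Induced.
Variables (G : sgraph) (V : finType) (f : V -> G).

Definition induced_rel : rel V := fun x y => adj (f x) (f y).
Lemma induced_sym : symmetric induced_rel.
Proof. by move=> x y; apply: adj_sym. Qed.
Lemma induced_irr : irreflexive induced_rel.
Proof. by move=> x; apply: adj_irr. Qed.

Definition induced : sgraph := SGraph induced_sym induced_irr.
End Induced.

Definition book_ramsey_graph (k l : nat) (G : sgraph) : Prop :=
  book_free k G /\ book_free l (compl G).

(** An induced subgraph inherits both avoidance properties, so a single witness
on N vertices refutes the arrow relation for every M <= N at once. *)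
Lemma arrows_books_gt (k l M : nat) (G : sgraph) :
  book_ramsey_graph k l G -> arrows M (book k) (book l) -> #|G| < M.
Proof.
move=> [freeG freeC] arrM; rewrite ltnNge; apply/negP=> leM.
pose f (i : 'I_M) : G := enum_val (widen_ord leM i).
have f_inj : injective f.
  by move=> i j /enum_val_inj/(congr1 val) /= eqij; apply: val_inj.
have [] := arrM (induced f) (card_ord M); apply/book_freeP.
  exact: (@book_free_embed (induced f) G f).
apply: (@book_free_embed (compl (induced f)) (compl G) f) => // u v.
by rewrite /= /compl_rel /= (inj_eq f_inj).
Qed.

Lemma arrows_books (k l N : nat) :
  (forall G : sgraph, #|G| = N -> ~ book_ramsey_graph k l G) ->
  arrows N (book k) (book l).
Proof.
move=> noG X cardX.
have [/existsP[x /existsP[y /andP[xy kxy]]]|noX] :=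
  boolP [exists x : X, exists y : X, adj x y && (k <= codeg x y)].
  by left; apply: contains_book kxy.
have [/existsP[x /existsP[y /andP[xy kxy]]]|noC] :=
  boolP [exists x : compl X, exists y : compl X, adj x y && (l <= codeg x y)].
  by right; apply: contains_book kxy.
case: (noG X cardX); split=> x y xy; rewrite ltnNge; apply/negP=> le_codeg.
  by case/negP: noX; apply/existsP; exists x; apply/existsP; exists y; rewrite xy.
by case/negP: noC; apply/existsP; exists x; apply/existsP; exists y; rewrite xy.
Qed.

(** * The upper bound *)

Section Counting.
Variable G : sgraph.
Implicit Types x y : G.

Definition deg x : nat := #|[set y | adj x y]|.

Lemma degE x : deg x = \sum_(y | adj x y) 1.
Proof. by rewrite sum1_card; apply: eq_card => y; rewrite inE. Qed.

Lemma sum_nbr (F : G -> nat) :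
  \sum_x \sum_(y | adj x y) F y = \sum_y deg y * F y.
Proof.
rewrite (exchange_big_dep xpredT) //=; apply: eq_bigr => y _.
rewrite sum_nat_const; congr (_ * _).
by apply: eq_card => x; rewrite !inE adj_sym.
Qed.

(** Each edge is counted once from its end of smaller rank and once from its
end of larger rank. *)
Lemma handshake : ~~ odd (\sum_x deg x).
Proof.
pose lt (x y : G) := enum_rank x < enum_rank y.
have -> : \sum_x deg x = \sum_x \sum_(y | adj x y && lt x y) 1
                       + \sum_x \sum_(y | adj x y && lt y x) 1.
  rewrite -big_split; apply: eq_bigr => x _.
  rewrite degE (bigID (lt x)) /=; congr (_ + _); apply: eq_bigl => y.
  rewrite /lt -leqNgt leq_eqVlt (inj_eq (@ord_inj _)).
  case: (boolP (adj x y)) => //= xy; rewrite (inj_eq enum_rank_inj).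
  by case: eqP => [eqyx|//]; rewrite eqyx adj_irr in xy.
rewrite [X in _ + X](exchange_big_dep xpredT) //=.
under [X in _ + X]eq_bigr => x _ do
  under eq_bigl => y do rewrite adj_sym.
by rewrite addnn odd_double.
Qed.
End Counting.

Section Goodman.
Variable G : sgraph.
Implicit Types x y : G.

Lemma deg_compl x : deg x + deg (x : compl G) = #|G|.-1.
Proof.
have complE : #|[set y | @adj (compl G) x y]| = #|[set~ x] :\: [set y | adj x y]|.
  by apply: eq_card => y; rewrite !inE /= /compl_rel eq_sym andbC.
rewrite /deg complE -(cardsC1 x) -[RHS](cardsID [set y | adj x y]); congr (_ + _).
apply: eq_card => y; rewrite !inE; case: eqP => //= ->.
by rewrite adj_irr.
Qed.

Definition private_deg x y : nat := #|[set z | adj y z & (z != x) && ~~ adj x z]|.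

(** Besides x, a neighbour of y is either a common neighbour of x and y or lies
outside the closed neighbourhood of x. *)
Lemma deg_split x y : adj x y -> deg y = codeg x y + (private_deg x y).+1.
Proof.
move=> xy; rewrite /deg (cardsD1 x) inE adj_sym xy add1n addnS.
congr _.+1; rewrite -(cardsID [set z | adj x z]); congr (_ + _).
  apply: eq_card => z; rewrite !inE; case: eqP => [->|] //=.
    by rewrite adj_irr.
  by rewrite andbC.
by apply: eq_card => z; rewrite !inE; do 2!case: (adj _ _); case: eqP.
Qed.
End Goodman.

(** The pairs formed by a neighbour y and a non-neighbour z of x are sorted by
the adjacency of y and z; nonadjacent pairs are counted from z, in the
complement. *)
Lemma deg_mul_compl (G : sgraph) (x : G) :
  deg x * deg (x : compl G) =
    \sum_(y | adj x y) private_deg x y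
    + \sum_(z : compl G | adj (x : compl G) z) private_deg (x : compl G) z.
Proof.
pose c (z : G) := (z != x) && ~~ adj x z.
have cE (z : G) : @adj (compl G) x z = c z by rewrite /= /compl_rel eq_sym.
have -> : \sum_(y | adj x y) private_deg x y
          = \sum_(y | adj x y) \sum_(z | c z) adj y z.
  apply: eq_bigr => y _; rewrite -big_mkcondr sum1_card.
  by apply: eq_card => z; rewrite !inE andbC.
have -> : \sum_(z : compl G | adj (x : compl G) z) private_deg (x : compl G) z
          = \sum_(z | c z) \sum_(y | adj x y) ~~ adj y z.
  rewrite (eq_bigl _ _ cE); apply: eq_bigr => z cz.
  rewrite -big_mkcondr sum1_card; apply: eq_card => y.
  rewrite [RHS]unfold_in inE cE /c /= /compl_rel [adj z y]adj_sym.
  case: (eqVneq y x) => [->|nyx] /=; first by rewrite adj_irr andbF.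
  case: (boolP (adj x y)) => xy /=; rewrite ?andbF // andbT.
  by case: (eqVneq z y) => //= ezy; move: cz; rewrite /c ezy xy andbF.
rewrite [X in _ + X]exchange_big -big_split /=.
rewrite degE big_distrl /=; apply: eq_bigr => y _.
rewrite -big_split mul1n /deg -sum1_card; apply: eq_big => z.
  by rewrite !inE -cE.
by case: (adj y z).
Qed.

(** The counting argument is tight exactly for regular graphs of degree
2n - 1, and parity excludes those. *)
Lemma no_book_ramsey_graph (n : nat) (G : sgraph) :
  0 < n -> #|G| = 4 * n - 1 -> ~ book_ramsey_graph n.-1 n G.
Proof.
move=> n_gt0 cardG [freeG freeC].
pose d (x : G) := deg x; pose d' (x : G) := deg (x : compl G).
have dD x : d x + d' x = 4 * n - 2 by rewrite /d /d' deg_compl cardG; lia.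
have local x : \sum_(y | adj x y) (d y).+1
    + \sum_(z | @adj (compl G) x z) d' z <= d x * d' x + n * (d x + d' x).
  rewrite /d /d' deg_mul_compl mulnDr !degE !big_distrr /= addnACA -!big_split /=.
  apply: leq_add; apply: leq_sum => y xy.
    by have := freeG x y xy; rewrite (deg_split xy); lia.
  by have := freeC x y xy; rewrite (@deg_split (compl G) x y xy); lia.
have global : \sum_x (d x * (d x).+1 + d' x * d' x)
    <= \sum_x (d x * d' x + n * (d x + d' x)).
  have <- : \sum_x (\sum_(y | adj x y) (d y).+1
      + \sum_(z | @adj (compl G) x z) d' z) = \sum_x (d x * (d x).+1 + d' x * d' x).
    by rewrite !big_split /= sum_nbr (@sum_nbr (compl G)).
  by apply: leq_sum => x _; apply: local.
(* With d x = 2n - 1 + t, the two sides differ by 3 t^2 + t. *)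
have termwise x : d x * d' x + n * (d x + d' x) <= d x * (d x).+1 + d' x * d' x
    ?= iff (d x == 2 * n - 1).
  have := dD x; move: (d x) (d' x) => a b ab; apply/leqifP.
  by case: eqP => ?; [apply/eqP|]; nia.
have [_ eq_sum] := leqif_sum (P := xpredT) (fun x _ => termwise x).
have /forallP regular : [forall x, d x == 2 * n - 1].
  rewrite -(eq_forallb (fun x => implyTb _)) -eq_sum eqn_leq global andbT.
  by apply: leq_sum => x _; apply: (termwise x).
have := handshake G; rewrite (eq_bigr (fun=> 2 * n - 1)) => [|x _]; last first.
  exact/eqP/regular.
rewrite sum_nat_const cardG oddM !oddB ?oddM //; lia.
Qed.

(** * Bicayley graphs *)

Local Open Scope ring_scope.

Lemma card_set_inj (V : finType) (f : V -> V) (P : pred V) :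
  injective f -> #|[set z | P (f z)]| = #|[set z | P z]|.
Proof.
move=> f_inj; rewrite -[LHS](card_imset _ f_inj); apply: eq_card => z.
have [g fK gK] := injF_bij f_inj.
by rewrite -[z]gK mem_imset // !inE.
Qed.

Lemma card_set_sum (U V : finType) (P : pred (U + V)) :
  #|[set z | P z]| = (#|[set z | P (inl z)]| + #|[set z | P (inr z)]|)%N.
Proof.
rewrite -!sum1_card big_sumType /=; congr addn.
  by apply: eq_bigl => z; rewrite !inE.
by apply: eq_bigl => z; rewrite !inE.
Qed.

Lemma sub_translate (V : zmodType) (x y z : V) : (z - x) - (y - x) = z - y.
Proof. by rewrite opprB addrA subrK. Qed.

Lemma sub_reflect (V : zmodType) (x y z : V) : (y - z) - (y - x) = x - z.
Proof. by rewrite opprB addrC addrA subrK. Qed.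

Section Differences.
Variable V : finZmodType.
Implicit Types (A S T : {set V}) (d : V).

Definition diff_count A d : nat := #|[set z in A | z - d \in A]|.

(** The connection set of the complement of the Cayley graph on A. *)
Definition nzcompl A : {set V} := [set z | (z != 0) && (z \notin A)].

Lemma diff_count_translate A x y :
  #|[set z | (z - x \in A) && (z - y \in A)]| = diff_count A (y - x).
Proof.
rewrite /diff_count -[RHS](card_set_inj _ (@addIr _ (- x))).
by apply: eq_card => z; rewrite !inE (sub_translate x y z).
Qed.

Lemma diff_count_reflect A x y :
  #|[set z | (x - z \in A) && (y - z \in A)]| = diff_count A (y - x).
Proof.
rewrite /diff_count -[RHS](card_set_inj _ (inj_comp (@addrI _ y) (@oppr_inj V))).
by apply: eq_card => z; rewrite !inE /= (sub_reflect x y z) andbC.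
Qed.

(** Inclusion-exclusion for the complement of the union of A and its translate
by d. *)
Lemma diff_countC A d : (diff_count (~: A) d + 2 * #|A| = #|V| + diff_count A d)%N.
Proof.
pose B : {set V} := [set z | z - d \in A].
have cardB : #|B| = #|A|.
  rewrite (card_set_inj (fun z => z \in A) (@addIr _ (- d))).
  by apply: eq_card => z; rewrite inE.
have -> : diff_count (~: A) d = #|~: (A :|: B)|.
  by apply: eq_card => z; rewrite !inE negb_or.
have -> : diff_count A d = #|A :&: B| by apply: eq_card => z; rewrite !inE.
have UI := cardsUI A B.
have : (#|A :|: B| + #|~: (A :|: B)|)%N = #|V| := cardsC _.
by rewrite cardB in UI; lia.
Qed.

Lemma nzcomplK A : 0 \notin A -> nzcompl (nzcompl A) = A.
Proof.
move=> A0; apply/setP=> z; rewrite !inE negb_and !negbK.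
by case: eqP => //= ->; rewrite (negPf A0).
Qed.

Lemma nzcompl0 A : 0 \notin nzcompl A.
Proof. by rewrite inE eqxx. Qed.

Lemma nzcompl_sym A : (forall z, (- z \in A) = (z \in A)) ->
  forall z, (- z \in nzcompl A) = (z \in nzcompl A).
Proof. by move=> symA z; rewrite !inE oppr_eq0 symA. Qed.

End Differences.
Arguments diff_count {V} A d%_R.

Section Bicayley.
Variables (V : finZmodType) (S T : {set V}).
Hypotheses (symS : forall z, (- z \in S) = (z \in S)) (S0 : 0 \notin S).

Definition bicayley_rel (u v : V + V) : bool :=
  match u, v with
  | inl x, inl y => y - x \in S
  | inr x, inr y => y - x \in nzcompl S
  | inl x, inr y => y - x \in T
  | inr x, inl y => x - y \in T
  end.

Lemma bicayley_sym : symmetric bicayley_rel.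
Proof.
move=> [x|x] [y|y] //=; rewrite -opprB; first by rewrite symS.
exact: nzcompl_sym.
Qed.

Lemma bicayley_irr : irreflexive bicayley_rel.
Proof.
by move=> [x|x]; apply/negP; rewrite /= subrr; apply/negP; rewrite ?nzcompl0.
Qed.

Definition bicayley : sgraph := SGraph bicayley_sym bicayley_irr.

Lemma codeg_bicayley_ll (x y : V) :
  codeg (inl x : bicayley) (inl y) = (diff_count S (y - x) + diff_count T (y - x))%N.
Proof. by rewrite /codeg card_set_sum /= !diff_count_translate. Qed.

Lemma codeg_bicayley_rr (x y : V) :
  codeg (inr x : bicayley) (inr y)
  = (diff_count T (y - x) + diff_count (nzcompl S) (y - x))%N.
Proof. by rewrite /codeg card_set_sum /= diff_count_translate diff_count_reflect. Qed.

(** A common neighbour in the first copy corresponds to an element w of T with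
w - d in S, and one in the second copy to an element w of T with w - d nonzero
and outside S, where d = y - x.  The two cases together exhaust T, apart from w = d. *)
Lemma codeg_bicayley_lr (x y : V) :
  (codeg (inl x : bicayley) (inr y) + (y - x \in T)%R = #|T|)%N.
Proof.
rewrite /codeg card_set_sum /=; set d := y - x.
have -> : #|[set z | (z - x \in S) && (y - z \in T)]|
          = #|[set w in T | w - d \in S]|.
  rewrite -[RHS](card_set_inj _ (inj_comp (@addrI _ y) (@oppr_inj V))).
  apply: eq_card => z; rewrite !inE /= (sub_reflect x y z).
  by rewrite -(opprB x z) (symS (x - z)) andbC.
have -> : #|[set z | (z - x \in T) && (z - y \in nzcompl S)]|
          = #|[set w in T | w - d \in nzcompl S]|.
  rewrite -[RHS](card_set_inj _ (@addIr _ (- x))).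
  by apply: eq_card => z; rewrite !inE (sub_translate x y z).
rewrite addnC (cardsD1 d T) -(cardsID [set w | w - d \in S] (T :\ d)).
congr (_ + (_ + _))%N; apply: eq_card => w; rewrite !inE.
  by case: (eqVneq w d) => [->|_]; rewrite ?subrr ?(negPf S0) ?andbF.
by rewrite subr_eq0; case: (w == d); case: (w \in T); rewrite ?andbF ?andbT.
Qed.

Lemma book_free_bicayley k :
    (forall d, d \in S -> diff_count S d + diff_count T d < k)%N ->
    (forall d, d \in nzcompl S -> diff_count (nzcompl S) d + diff_count T d < k)%N ->
    (#|T| <= k)%N ->
  book_free k bicayley.
Proof.
move=> kS kS' kT [x|x] [y|y] xy.
- by rewrite codeg_bicayley_ll kS.
- by have := codeg_bicayley_lr x y; rewrite (xy : y - x \in T) addn1 => ->.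
- have -> : codeg (inr x : bicayley) (inl y) = codeg (inl y : bicayley) (inr x).
    by apply: eq_card => z; rewrite !inE andbC.
  by have := codeg_bicayley_lr y x; rewrite (xy : x - y \in T) addn1 => ->.
- by rewrite codeg_bicayley_rr addnC kS'.
Qed.

End Bicayley.

(** The family of bicayley graphs is closed under complementation. *)
Lemma compl_bicayley (V : finZmodType) (S T : {set V}) symS S0 u v :
  @adj (compl (@bicayley V S T symS S0)) u v ->
  bicayley_rel (nzcompl S) (~: T) u v.
Proof.
rewrite /= /compl_rel => /andP[nuv].
case: u v nuv => [x|x] [y|y] nuv; rewrite [adj _ _]/= => nxy.
- rewrite /= inE nxy andbT subr_eq0.
  by apply: contraNneq nuv => ->.
- by rewrite /= inE.
- by rewrite /= inE.
- rewrite /= inE nxy andbT subr_eq0.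
  by apply: contraNneq nuv => ->.
Qed.

(** The two bounds for the complement follow from those for the graph: the
roles of S and its complement are exchanged, and since |T| = n - 1 and |V| = 2n - 1,
replacing T by its complement increases each difference count by at most 1, which
is the difference between the bounds n - 2 and n - 1 on the codegrees. *)
Lemma bicayley_ramsey (V : finZmodType) (S T : {set V}) (n : nat) :
    #|V| = (2 * n - 1)%N -> #|T| = n.-1 ->
    (forall z, (- z \in S) = (z \in S)) -> 0 \notin S ->
    (forall d, d \in S -> diff_count S d + diff_count T d < n.-1)%N ->
    (forall d, d \in nzcompl S -> diff_count (nzcompl S) d + diff_count T d < n.-1)%N ->
  exists2 G : sgraph, #|G| = (4 * n - 2)%N & book_ramsey_graph n.-1 n G.
Proof.
move=> cardV cardT symS S0 boundS boundS'.
exists (bicayley T symS S0); first by rewrite card_sum !cardV; lia.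
split; first by apply: book_free_bicayley; rewrite ?cardT.
have diff_countTC d : (diff_count (~: T) d <= (diff_count T d).+1)%N.
  by have := diff_countC T d; lia.
pose H := bicayley (~: T) (nzcompl_sym symS) (nzcompl0 S).
pose f (u : compl (bicayley T symS S0)) : H := u.
apply: (@book_free_embed _ _ f) => [u v //|u v /compl_bicayley //|].
apply: book_free_bicayley.
- by move=> d /boundS'; have := diff_countTC d; lia.
- by move=> d; rewrite nzcomplK // => /boundS; have := diff_countTC d; lia.
- by have : (#|T| + #|~: T|)%N = #|V| := cardsC T; lia.
Qed.

(** * The Paley construction *)

Section Paley.
Variables (F : finFieldType) (h : nat).
Hypotheses (cardF : #|F| = (2 * h).+1) (h_even : ~~ odd h).

(** Euler's criterion is taken as the definition of the nonzero squares: it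
makes multiplicativity immediate. *)
Definition residues : {set F} := [set z | z ^+ h == 1].
Local Notation Q := residues.
Local Notation N := (nzcompl Q).

Lemma half_gt0 : (0 < h)%N.
Proof. by have := finNzRing_gt1 F; rewrite cardF; case: h. Qed.

Lemma residues0 : 0 \notin Q.
Proof. by rewrite inE expr0n eqn0Ngt half_gt0 eq_sym oner_eq0. Qed.

Lemma residues1 : 1 \in Q.
Proof. by rewrite inE expr1n. Qed.

Lemma residuesN z : (- z \in Q) = (z \in Q).
Proof. by rewrite !inE exprNn -signr_odd (negPf h_even) mul1r. Qed.

Lemma residuesV z : (z^-1 \in Q) = (z \in Q).
Proof. by rewrite !inE exprVn invr_eq1. Qed.

Lemma nonresiduesN z : (- z \in N) = (z \in N).
Proof. exact: nzcompl_sym residuesN z. Qed.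

Lemma nonresiduesV z : (z^-1 \in N) = (z \in N).
Proof. by rewrite !inE invr_eq0 exprVn invr_eq1. Qed.

Lemma nonresidueE z : (z \in N) -> z ^+ h = -1.
Proof.
rewrite !inE => /andP[z0 zh]; apply/eqP; rewrite -addr_eq0.
have : (z ^+ h - 1) * (z ^+ h + 1) == 0.
  rewrite -subr_sqr expr1n -exprM mulnC subr_eq0.
  by rewrite -(inj_eq (mulIf z0)) mul1r -exprSr -cardF expf_card.
by rewrite mulf_eq0 subr_eq0 (negPf zh).
Qed.

Lemma mulr_residue z d : d \in Q ->
  ((z * d \in Q) = (z \in Q)) * ((z * d \in N) = (z \in N)).
Proof.
move=> dQ; have d0 : d != 0 by apply: contraTneq dQ => ->; apply: residues0.
have eqQ : (z * d \in Q) = (z \in Q).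
  by move: dQ; rewrite !inE exprMn => /eqP->; rewrite mulr1.
by split=> //; rewrite inE [RHS]inE eqQ mulf_eq0 (negPf d0) orbF.
Qed.

Lemma mulr_nonresidue z d : d \in N ->
  ((z * d \in Q) = (z \in N)) * ((z * d \in N) = (z \in Q)).
Proof.
move=> dN; have [d0 dnQ] : d != 0 /\ d \notin Q by move: dN; rewrite inE => /andP.
have eqQ : (z * d \in Q) = (z \in N).
  have [->|z0] := eqVneq z 0.
    by rewrite mul0r (negPf residues0) inE eqxx.
  have [zQ|znQ] := boolP (z \in Q).
    by rewrite mulrC (mulr_residue d zQ).1 (negPf dnQ) inE zQ andbF.
  have zN : z \in N by rewrite inE z0.
  by rewrite zN inE exprMn !nonresidueE // mulrNN mulr1 eqxx.
split=> //; rewrite inE eqQ inE mulf_eq0 (negPf d0) orbF.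
have [->|z0] := eqVneq z 0; first by rewrite (negPf residues0).
by rewrite negbK.
Qed.

(** There are at most h residues, as roots of X^h - 1.  Multiplication by a
nonresidue injects the nonresidues into the residues, so there are at most h of
them as well, and both bounds are attained since there are 2h nonzero elements. *)
Lemma card_residues_nonresidues : #|Q| = h /\ #|N| = h.
Proof.
have leQ : (#|Q| <= h)%N.
  rewrite cardE; apply: (@max_unity_roots F h (enum Q) half_gt0).
    by apply/allP=> z; rewrite mem_enum inE unity_rootE.
  exact: enum_uniq.
have cardQN : (#|Q| + #|N|)%N = (2 * h)%N.
  have := cardsC1 (0 : F); rewrite cardF /= => <-.
  rewrite -(cardsID Q [set~ 0]); congr (_ + _)%N; apply: eq_card => z.
    by rewrite in_setI in_setC1; case: eqP => // ->; rewrite (negPf residues0).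
  by rewrite !inE andbC.
have leNQ : (#|N| <= #|Q|)%N.
  have [->|[g gN]] := set_0Vmem N; first by rewrite cards0.
  have g0 : g != 0 by move: gN; rewrite inE => /andP[].
  rewrite -(card_imset _ (mulIf g0)); apply: subset_leq_card.
  by apply/subsetP=> _ /imsetP[z zN ->]; rewrite (mulr_nonresidue z gN).1.
lia.
Qed.

Definition cyclotomic (A B : {set F}) : nat := #|[set z in A | z - 1 \in B]|.

(** The bijection is z |-> 1 - z, using that -1 is a square. *)
Lemma cyclotomic_QN_eq_NQ : cyclotomic Q N = cyclotomic N Q.
Proof.
rewrite -[RHS](card_set_inj _ (inj_comp (@addrI _ 1) (@oppr_inj F))).
apply: eq_card => z; rewrite inE [RHS]inE /= andbC.
by rewrite -nonresiduesN opprB addrAC subrr add0r residuesN.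
Qed.

(** The bijection is z |-> 1 / z, as 1 / z - 1 = (1 - z) / z. *)
Lemma cyclotomic_NQ_eq_NN : cyclotomic N Q = cyclotomic N N.
Proof.
rewrite -[RHS](card_set_inj _ (@invr_inj F)).
apply: eq_card => z; rewrite inE [RHS]inE nonresiduesV.
apply: andb_id2l => zN; have z0 : z != 0 by move: zN; rewrite inE => /andP[].
have zVN : z^-1 \in N by rewrite nonresiduesV.
have -> : z^-1 - 1 = (1 - z) * z^-1 by rewrite mulrBl mul1r divff.
by rewrite (mulr_nonresidue _ zVN).2 -residuesN opprB.
Qed.

Lemma cyclotomic_row_Q : #|Q| = (cyclotomic Q Q + cyclotomic Q N).+1.
Proof.
rewrite (cardsD1 1) residues1 add1n -(cardsID [set z | z - 1 \in Q]).
congr (_ + _).+1; apply: eq_card => z; rewrite !inE.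
  case: (eqVneq z 1) => [->|_] //=.
  by have := residues0; rewrite inE subrr => /negPf->; rewrite andbF.
by rewrite subr_eq0; case: (z == 1); rewrite ?andbF // andbC.
Qed.

Lemma cyclotomic_row_N : #|N| = (cyclotomic N Q + cyclotomic N N)%N.
Proof.
rewrite -(cardsID [set z | z - 1 \in Q]).
congr (_ + _)%N; apply: eq_card => z; rewrite !inE //.
rewrite subr_eq0; case: (eqVneq z 1) => [->|_] /=; last by rewrite andbC.
by rewrite expr1n eqxx !andbF.
Qed.

Lemma diff_count_scale (A B : {set F}) d : d != 0 ->
  (forall z, (z * d \in A) = (z \in B)) -> diff_count A d = cyclotomic B B.
Proof.
move=> d0 AB; rewrite /diff_count -(card_set_inj _ (mulIf d0)).
by apply: eq_card => z; rewrite !inE AB -[X in _ - X]mul1r -mulrBl AB.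
Qed.

(** With b the common value of (Q,N), (N,Q) and (N,N), counting Q and N row by
row gives (Q,Q) + b + 1 = h and 2b = h.  Dividing by d, the difference counts of Q
and N at d are (Q,Q) or (N,N), so that the two sums to be bounded are
2 (Q,Q) = h - 2 and (Q,Q) + (N,N) = h - 1. *)
Lemma paley_ramsey :
  exists2 G : sgraph, #|G| = (4 * h + 2)%N & book_ramsey_graph h h.+1 G.
Proof.
have [cardQ cardN] := card_residues_nonresidues.
have := cyclotomic_row_Q; have := cyclotomic_row_N.
rewrite cyclotomic_QN_eq_NQ cyclotomic_NQ_eq_NN cardQ cardN => rowN rowQ.
have [||||||G cardG ramG] := @bicayley_ramsey F Q Q h.+1.
- by rewrite cardF; lia.
- by [].
- exact: residuesN.
- exact: residues0.
- move=> d dQ; have d0 : d != 0 by apply: contraTneq dQ => ->; apply: residues0.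
  rewrite (diff_count_scale d0 (fun z => (mulr_residue z dQ).1)) /=; lia.
- move=> d dN; have d0 : d != 0 by move: dN; rewrite inE => /andP[].
  rewrite (diff_count_scale d0 (fun z => (mulr_nonresidue z dN).1)).
  rewrite (diff_count_scale d0 (fun z => (mulr_nonresidue z dN).2)) /=; lia.
by exists G => //; rewrite cardG; lia.
Qed.
End Paley.

Local Close Scope ring_scope.

Definition has_book_ramsey_graph (n : nat) : Prop :=
  exists2 G : sgraph, #|G| = 4 * n - 2 & book_ramsey_graph n.-1 n G.

Lemma paley_has_ramsey n : 0 < n -> prime_power (2 * n - 1) ->
  2 * n - 1 = 1 %[mod 4] -> has_book_ramsey_graph n.
Proof.
case: n => // h _ [p [k [p_pr k_gt0 qE]]] q1.
have [F _ cardF] := pPrimePowerField p_pr k_gt0.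
have [||G cardG ramG] := @paley_ramsey F h.
- by rewrite cardF -qE; lia.
- by lia.
by exists G => //; rewrite cardG; lia.
Qed.

(** * Verification by evaluation *)

(** This turns cardinals over ordinals into counts over lists of numbers, which
evaluate efficiently. *)
Lemma card_ord_count m (P : pred nat) :
  #|[set i : 'I_m | P i]| = count P (iota 0 m).
Proof.
by rewrite -val_enum_ord count_map enumT cardsE cardE /enum_mem size_filter.
Qed.

Section CyclicCheck.
Variables (m : nat) (s t : seq nat).

Definition diff_count_mod (r : seq nat) (d : nat) : nat :=
  count (fun z => (z \in r) && ((z + (m - d)) %% m \in r)) (iota 0 m).

Definition cyclic_check (k : nat) : bool :=
  let s' := [seq z <- iota 1 m.-1 | z \notin s] in
  [&& 0 \notin s, count (mem t) (iota 0 m) == k,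
      all (fun z => ((m - z) %% m \in s) == (z \in s)) (iota 0 m)
    & all (fun d => diff_count_mod (if d \in s then s else s') d + diff_count_mod t d < k)
        (iota 1 m.-1)].
End CyclicCheck.

Lemma diff_count_ord m (r : seq nat) (d : 'I_m.+1) :
  diff_count [set i : 'I_m.+1 | val i \in r] d = diff_count_mod m.+1 r d.
Proof.
rewrite /diff_count_mod -card_ord_count; apply: eq_card => z.
by rewrite !inE /= modnDmr.
Qed.

Lemma cyclic_has_ramsey (n : nat) (s t : seq nat) :
  0 < n -> cyclic_check (2 * n - 1) s t n.-1 -> has_book_ramsey_graph n.
Proof.
move=> n_gt0; have -> : 2 * n - 1 = (2 * n - 2).+1 by lia.
set m := 2 * n - 2; rewrite /cyclic_check.
set s' := filter _ _ => /and4P[s0 /eqP cardt /allP syms /allP bound].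
pose S := [set i : 'I_m.+1 | val i \in s]; pose T := [set i : 'I_m.+1 | val i \in t].
have S'E : nzcompl S = [set i : 'I_m.+1 | val i \in s'].
  apply/setP=> i; rewrite !inE mem_filter mem_iota andbC; congr (_ && _).
  by rewrite -val_eqE /= add1n ltn_ord andbT lt0n.
have boundS (d : 'I_m.+1) : d != 0%R ->
    diff_count_mod m.+1 (if val d \in s then s else s') d
      + diff_count_mod m.+1 t d < n.-1.
  move=> d0; apply: bound; rewrite mem_iota /= add1n ltn_ord andbT lt0n.
  by rewrite -val_eqE in d0.
apply: (@bicayley_ramsey 'I_m.+1 S T n).
- by rewrite card_ord /m; lia.
- by rewrite card_ord_count.
- move=> z; rewrite !inE /=; apply/eqP/syms.
  by rewrite mem_iota /= add0n ltn_ord.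
- by rewrite inE.
- move=> d dS; have d0 : d != 0%R by apply: contraTneq dS => ->; rewrite inE.
  by have := boundS d d0; rewrite !diff_count_ord; move: dS; rewrite inE => ->.
- move=> d; rewrite inE => /andP[d0 dS].
  rewrite S'E !diff_count_ord; have := boundS d d0.
  by rewrite inE in dS; rewrite (negPf dS).
Qed.

Section Adjacency.
Variables (N : nat) (rows : seq (seq nat)).

(** Symmetrised, so that it suffices to list the larger neighbours of each
vertex. *)
Definition row_adj (x y : nat) : bool :=
  (x != y) && ((y \in nth [::] rows x) || (x \in nth [::] rows y)).

Definition row_rel : rel 'I_N := fun x y => row_adj x y.

Lemma row_sym : symmetric row_rel.
Proof. by move=> x y; rewrite /row_rel /row_adj eq_sym orbC. Qed.

Lemma row_irr : irreflexive row_rel.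
Proof. by move=> x; rewrite /row_rel /row_adj eqxx. Qed.

Definition row_graph : sgraph := SGraph row_sym row_irr.

Definition row_check (k l : nat) : bool :=
  let e' x y := (x != y) && ~~ row_adj x y in
  let codeg_lt (e : rel nat) b x y :=
    e x y ==> (count (fun z => e x z && e y z) (iota 0 N) < b) in
  all (fun x => all (fun y => codeg_lt row_adj k x y && codeg_lt e' l x y)
    (iota 0 N)) (iota 0 N).

Lemma row_checkP k l : row_check k l -> book_ramsey_graph k l row_graph.
Proof.
move=> /allP check; split=> x y xy; rewrite /codeg.
  have /check/allP/(_ (val y)) : val x \in iota 0 N by rewrite mem_iota ltn_ord.
  rewrite mem_iota ltn_ord => /(_ isT)/andP[/implyP/(_ xy) + _].
  by rewrite -card_ord_count.
have /check/allP/(_ (val y)) : val x \in iota 0 N by rewrite mem_iota ltn_ord.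
rewrite mem_iota ltn_ord => /(_ isT)/andP[_ /implyP/(_ xy)].
by rewrite -card_ord_count.
Qed.
End Adjacency.

(** * The Ramsey numbers *)

(** Each entry is n followed by S and T.  The sets come from a computer search,
by enumeration of the sets invariant under a group of multipliers or by
simulated annealing. *)
Definition cyclic_pairs : seq (nat * seq nat * seq nat) := [::
  (1, [::], [::]);
  (6, [:: 1; 2; 4; 7; 9; 10], [:: 0; 1; 3; 6; 7]);
  (8, [:: 1; 2; 4; 7; 8; 11; 13; 14], [:: 0; 1; 2; 4; 5; 8; 10]);
  (10, [:: 1; 2; 3; 6; 8; 11; 13; 16; 17; 18],
       [:: 0; 1; 2; 4; 8; 10; 11; 14; 15]);
  (11, [:: 2; 3; 5; 6; 7; 14; 15; 16; 18; 19],
       [:: 0; 1; 3; 7; 11; 13; 16; 17; 18; 19]);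
  (12, [:: 3; 4; 6; 7; 8; 9; 14; 15; 16; 17; 19; 20],
       [:: 0; 1; 2; 3; 7; 8; 12; 16; 18; 20; 21]);
  (14, [:: 1; 3; 4; 5; 7; 12; 13; 14; 15; 20; 22; 23; 24; 26],
       [:: 0; 2; 3; 4; 6; 7; 9; 15; 16; 19; 20; 22; 25]);
  (16, [:: 1; 2; 4; 7; 8; 10; 11; 15; 16; 20; 21; 23; 24; 27; 29; 30],
       [:: 0; 3; 5; 12; 13; 15; 16; 17; 18; 20; 23; 25; 27; 29; 30]);
  (17, [:: 1; 2; 3; 4; 7; 9; 13; 16; 17; 20; 24; 26; 29; 30; 31; 32],
       [:: 3; 4; 6; 7; 8; 12; 13; 15; 18; 20; 21; 25; 26; 27; 29; 30]);
  (18, [:: 1; 2; 3; 4; 6; 9; 13; 14; 15; 20; 21; 22; 26; 29; 31; 32; 33; 34],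
       [:: 0; 3; 4; 6; 8; 9; 12; 13; 14; 17; 21; 23; 24; 25; 28; 31; 33]);
  (20, [:: 1; 4; 6; 10; 13; 14; 15; 16; 17; 18; 21; 22; 23; 24; 25; 26; 29;
           33; 35; 38],
       [:: 0; 1; 2; 3; 4; 5; 8; 9; 10; 11; 14; 16; 20; 22; 25; 27; 29; 32;
           35])].

Lemma has_ramsey_cyclic (n : nat) :
  n \in [seq c.1.1 | c <- cyclic_pairs] -> has_book_ramsey_graph n.
Proof.
move=> /mapP[[[n' s] t] in_pairs ->] /=.
have /allP/(_ _ in_pairs)/andP[] : all (fun c : nat * seq nat * seq nat =>
    (0 < c.1.1) && cyclic_check (2 * c.1.1 - 1) c.1.2 c.2 c.1.1.-1) cyclic_pairs.
  by vm_compute.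
exact: cyclic_has_ramsey.
Qed.

(** The parameters n with 2n - 1 = p ^ k = 1 mod 4, as triples n, p, k. *)
Definition paley_parameters : seq (nat * nat * nat) := [::
  (3, 5, 1); (5, 3, 2); (7, 13, 1); (9, 17, 1); (13, 5, 2); (15, 29, 1);
  (19, 37, 1)].

Lemma has_ramsey_small_paley (n : nat) :
  n \in [seq c.1.1 | c <- paley_parameters] -> has_book_ramsey_graph n.
Proof.
move=> /mapP[[[n' p] k] in_params ->] /=.
have /allP/(_ _ in_params)/= /and5P[n_gt0 p_pr k_gt0 /eqP qE /eqP q1] :
  all (fun c : nat * nat * nat => let: (n, p, k) := c in
    [&& 0 < n, prime p, 0 < k, 2 * n - 1 == p ^ k & 2 * n - 1 == 1 %[mod 4]])
    paley_parameters by [].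
by apply: paley_has_ramsey => //; exists p, k.
Qed.

(** The complete bipartite graph with parts of size 3. *)
Lemma has_ramsey_2 : has_book_ramsey_graph 2.
Proof.
exists (row_graph 6 (nseq 3 [:: 3; 4; 5])); first exact: card_ord.
exact: row_checkP.
Qed.

(** No pair S, T in the group of order 7 works here; the graph was found by
simulated annealing over all graphs on 14 vertices. *)
Lemma has_ramsey_4 : has_book_ramsey_graph 4.
Proof.
exists (row_graph 14 [:: [:: 3; 4; 5; 6; 7; 9]; [:: 2; 4; 7; 8; 10; 11];
  [:: 3; 5; 8; 10]; [:: 8; 10; 12; 13]; [:: 7; 8; 9; 12]; [:: 6; 9; 11];
  [:: 7; 8; 11; 13]; [:: 10; 13]; [:: 12]; [:: 10; 11; 12]; [:: 13];
  [:: 12; 13]; [:: 13]]); first exact: card_ord.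
by apply: row_checkP; vm_compute.
Qed.

Lemma has_ramsey_small (n : nat) : 0 < n -> n <= 20 -> has_book_ramsey_graph n.
Proof.
move=> n_gt0 n_le20.
have /allP/(_ n) : all (fun n => [|| n == 2, n == 4,
    n \in [seq c.1.1 | c <- paley_parameters]
    | n \in [seq c.1.1 | c <- cyclic_pairs]]) (iota 1 20) by [].
rewrite mem_iota n_gt0 => /(_ n_le20)/or4P[/eqP->|/eqP->||].
- exact: has_ramsey_2.
- exact: has_ramsey_4.
- exact: has_ramsey_small_paley.
- exact: has_ramsey_cyclic.
Qed.

Lemma book_ramsey_number (n : nat) : 0 < n -> has_book_ramsey_graph n ->
  is_ramsey_number (book n.-1) (book n) (4 * n - 1).
Proof.
move=> n_gt0 [G cardG ramG]; split; first by lia.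
- by apply: arrows_books => X; apply: no_book_ramsey_graph.
- by move=> M _ /(arrows_books_gt ramG); rewrite cardG; lia.
Qed.

Theorem theorem2 :
  (forall n : nat, 0 < n -> n <= 20 ->
     is_ramsey_number (book n.-1) (book n) (4 * n - 1)) /\
  (forall n : nat, 0 < n -> prime_power (2 * n - 1) ->
     2 * n - 1 = 1 %[mod 4] ->
     is_ramsey_number (book n.-1) (book n) (4 * n - 1)).
Proof.
split=> n n_gt0.
- by move=> n_le20; apply/book_ramsey_number/has_ramsey_small.
- by move=> q_pp q1; apply/book_ramsey_number/paley_has_ramsey.
Qed.
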